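(* For every integer $d>3$, let $A_d$ be the $(d-2)\times d$ matrix whose $i$-th row ($1\le i\le d-2$) has entries $1$ in columns $i$ and $i+1$, entry $-1$ in column $i+2$, and $0$ elsewhere (so $A_dx=0$ means $x_{i+2}=x_i+x_{i+1}$ for all $i$). Then $$F_{d+1}\le r(A_d)\le (d^2-d+1)F_{d-1}F_{d-2},$$ where $F_i$ is the Fibonacci sequence with $F_0=0$, $F_1=1$, $F_{i+2}=F_i+F_{i+1}$.
   Context: For a positive integer $N$, $[N]=\{1,\dots,N\}$. A $k$-coloring of a set $X$ is a surjective map $c:X\to\{1,\dots,k\}$; its color classes are the preimages of single colors. A $k$-coloring of $[kn]$ is equinumerous if every color class has exactly $n$ elements. Given a coloring of a set $S$ of integers, a vector is rainbow if all its entries lie in $S$ and its entries receive pairwise distinct colors. A rational matrix $A$ is rainbow partition $k$-regular if for all positive integers $n$ and every equinumerous $k$-coloring of $[kn]$ there exists a rainbow vector in $\ker(A)$. The rainbow number $r(A)$ is the smallest $k$ such that $A$ is rainbow partition $k$-regular. *)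

(* Defs.v *)
From mathcomp Require Import all_boot all_order all_algebra.

Set Implicit Arguments.
Unset Strict Implicit.
Unset Printing Implicit Defensive.

Import GRing.Theory.
Local Open Scope ring_scope.

Fixpoint fib (n : nat) : nat :=
  match n with
  | 0 => 0
  | m.+1 => match m with 0 => 1 | p.+1 => fib p + fib m end
  end%N.

Definition interval (N : nat) : seq nat := iota 1 N.

(* A coloring of S is represented by a total function on nat of which only the
   values on S are ever used. *)
Definition coloring (k : nat) (S : seq nat) (c : nat -> nat) : Prop :=
  (forall x, x \in S -> 1 <= c x <= k)%N /\
  (forall j, (1 <= j <= k)%N -> exists2 x, x \in S & c x = j).

Definition color_class (S : seq nat) (c : nat -> nat) (j : nat) : seq nat :=
  [seq x <- S | c x == j].

Definition equinumerous_coloring (k n : nat) (c : nat -> nat) : Prop :=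
  coloring k (interval (k * n)) c /\
  (forall j, (1 <= j <= k)%N ->
     size (color_class (interval (k * n)) c j) = n).

Definition rainbow (S : seq nat) (c : nat -> nat) (d : nat)
    (x : 'cV[rat]_d) : Prop :=
  exists y : 'I_d -> nat,
    [/\ forall i, x i 0 = (y i)%:R,
        forall i, y i \in S
      & forall i j, i != j -> c (y i) <> c (y j)].

Definition rainbow_partition_regular (m d : nat) (A : 'M[rat]_(m, d))
    (k : nat) : Prop :=
  forall (n : nat) (c : nat -> nat),
    (0 < n)%N -> equinumerous_coloring k n c ->
    exists x : 'cV[rat]_d, rainbow (interval (k * n)) c x /\ A *m x = 0.

(* r(A) = r; in particular, some k for which A is regular exists. *)
Definition is_rainbow_number (m d : nat) (A : 'M[rat]_(m, d)) (r : nat) : Prop :=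
  [/\ (0 < r)%N, rainbow_partition_regular A r
    & forall k, (0 < k)%N -> rainbow_partition_regular A k -> (r <= k)%N].

Definition fib_matrix (d : nat) : 'M[rat]_(d - 2, d) :=
  \matrix_(i < d - 2, j < d)
    if ((j == i :> nat) || (j == i.+1 :> nat)) then 1
    else if (j == i.+2 :> nat) then -1
    else 0.

(* Main.v *)
Require Import Defs.
From mathcomp Require Import all_boot all_order all_algebra.
From mathcomp Require Import zify.
From Stdlib Require Import Classical_Prop.

Set Implicit Arguments.
Unset Strict Implicit.
Unset Printing Implicit Defensive.

(** Kernel vectors are the sequences [a, b, a + b, a + 2 b, ...].

    Lower bound.  For [4 <= k < F_{d+1}] colour [1 .. 2k] by the pairs
    [{1,4}], [{2,3}], [{5,7}], [{6,8}], [{9,10}], [{11,12}], ...  The last entry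
    [F_{d-2} a + F_{d-1} b] is at most [2 F_{d+1} - 2], which leaves only a dozen
    starting pairs [(a, b)], and each of them already repeats a colour among its
    first four entries.

    Upper bound.  Let [P = F_{d-1}], [Q = F_{d-2}], [D = d^2 - d + 1] and
    [k = D P Q].  There are at least [P Q binom(D n, 2)] positive kernel vectors
    in [1 .. k n].  One that is not rainbow either has [a = b] (at most [k n] of
    these) or has two distinct entries of the same colour; since two entries
    determine the vector, there are at most [binom(d, 2) k n (n - 1)] of the
    latter, and the two bounds together are too small. *)

(** * Sequences with the Fibonacci recurrence *)

(** The general solution F_{i-1} a + F_i b of the recurrence; the case split supplies F_{-1} = 1 at
    index 0. *)
Definition gfib (a b i : nat) : nat :=
  if i is j.+1 then a * fib j + b * fib j.+1 else a.

Lemma fibSS n : fib n.+2 = fib n + fib n.+1.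
Proof. by []. Qed.

Lemma gfibSS a b i : gfib a b i.+2 = gfib a b i + gfib a b i.+1.
Proof. by case: i => [|i]; rewrite /gfib ?fibSS /=; lia. Qed.

Lemma fib_gt0 n : 0 < fib n.+1.
Proof. by elim: n => [|n IH] //; rewrite fibSS; lia. Qed.

Lemma gfib_gt0 a b i : 0 < a -> 0 < b -> 0 < gfib a b i.
Proof.
move=> a0 b0; case: i => [|i] //=; have := fib_gt0 i.
by rewrite -/(fib i.+1); nia.
Qed.

Lemma gfib_ltS a b i : 0 < a -> 0 < b -> gfib a b i.+1 < gfib a b i.+2.
Proof. by move=> a0 b0; rewrite gfibSS; have := gfib_gt0 i a0 b0; lia. Qed.

(** Only entries 0 and 1 can be out of order, since [a] may exceed [b]; hence [1 < j]. *)
Lemma gfib_lt a b i j : 0 < a -> 0 < b -> 1 < j -> i < j ->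
  gfib a b i < gfib a b j.
Proof.
move=> a0 b0; elim: j => [|[|j] IH] // _ lt_ij.
have lt_j := gfib_ltS j a0 b0.
have [->|ne_ij] := eqVneq i j.+1; first by [].
case: j IH lt_ij lt_j ne_ij => [|j] IH lt_ij lt_j ne_ij.
  have -> : i = 0 by lia.
  by rewrite gfibSS; have := gfib_gt0 1 a0 b0; lia.
by apply: ltn_trans lt_j; apply: IH; lia.
Qed.

Lemma gfib_le a b i d : 0 < a -> 0 < b -> 2 < d -> i < d ->
  gfib a b i <= gfib a b d.-1.
Proof.
move=> a0 b0 d2 lt_id; have [->|ne] := eqVneq i d.-1; first by [].
by apply/ltnW/gfib_lt; lia.
Qed.

Lemma gfib_neq a b i j : 0 < a -> 0 < b -> a != b -> i < j ->
  gfib a b i != gfib a b j.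
Proof.
move=> a0 b0 ne_ab lt_ij; have [j1|j1] := leqP j 1; last first.
  by rewrite neq_ltn gfib_lt.
have -> : i = 0 by lia.
have -> : j = 1 by lia.
by rewrite /gfib /=; lia.
Qed.

(** The tail from index [i] is again such a sequence, seeded by entries [i] and [i.+1]. *)
Lemma gfibD a b i m :
  gfib a b (i + m.+1) = gfib a b i * fib m + gfib a b i.+1 * fib m.+1.
Proof.
elim: m {-2}m (leqnn m) => [|N IH] [|[|m]] le_mN //; rewrite ?addn1.
- by rewrite /=; lia.
- by rewrite /=; lia.
- by rewrite addn2 gfibSS /=; lia.
rewrite !addnS gfibSS -!addnS !IH ?fibSS; lia.
Qed.

Lemma gfib_inj_step a b a' b' i :
  gfib a b i = gfib a' b' i -> gfib a b i.+1 = gfib a' b' i.+1 ->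
  a = a' /\ b = b'.
Proof.
elim: i => [|i IH] e1 e2; first by move: e1 e2; rewrite /gfib /=; lia.
by apply: IH => //; move: e1 e2; rewrite !gfibSS; lia.
Qed.

(** By [gfibD], entry [j] is entry [i] times a constant plus entry [i.+1] times a positive one, so
    entry [i.+1] is determined too; the recurrence then runs backwards to the seeds. *)
Lemma gfib_inj a b a' b' i j : i < j ->
  gfib a b i = gfib a' b' i -> gfib a b j = gfib a' b' j ->
  a = a' /\ b = b'.
Proof.
move=> lt_ij ei; have -> : j = i + (j - i.+1).+1 by lia.
rewrite !gfibD ei => ej; apply: (@gfib_inj_step _ _ _ _ i) => //.
by have := fib_gt0 (j - i.+1); nia.
Qed.

Lemma gfib_rec d (z : nat -> nat) :
  (forall i, i.+2 < d -> z i.+2 = z i + z i.+1) ->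
  forall i, i < d -> z i = gfib (z 0) (z 1) i.
Proof.
move=> rec i; elim: i {-2}i (leqnn i) => [|N IH] [|[|i]] le_iN lti //.
  by rewrite /gfib muln0 muln1.
by rewrite rec // gfibSS (IH i) ?(IH i.+1) //; lia.
Qed.

(** * Kernel vectors and their seeds *)

Section Kernel.
Local Open Scope ring_scope.
Import GRing.Theory Num.Theory.

Lemma fib_matrix_mulE (d : nat) (z : nat -> nat) (x : 'cV[rat]_d) (i : 'I_(d - 2)) :
  (forall j : 'I_d, x j 0 = (z j)%:R) ->
  (fib_matrix d *m x) i 0 = (z i)%:R + (z i.+1)%:R - (z i.+2)%:R.
Proof.
move=> xz.
have lti2 : (i.+2 < d)%N by have := ltn_ord i; lia.
have lti1 : (i.+1 < d)%N by lia.
have lti0 : (i < d)%N by lia.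
rewrite mxE (bigD1 (Ordinal lti0)) //= (bigD1 (Ordinal lti1)) /=; last first.
  by rewrite -val_eqE /=; lia.
rewrite (bigD1 (Ordinal lti2)) /=; last by rewrite -!val_eqE /=; lia.
rewrite big1 => [|j]; last first.
  rewrite -!val_eqE /= => /andP[/andP[n0 n1] n2].
  by rewrite mxE (negPf n0) (negPf n1) (negPf n2) mul0r.
rewrite !mxE /= !xz /= !eqxx orbT.
have -> : ((i.+2 == i) || (i.+2 == i.+1))%N = false by lia.
by rewrite !mul1r addr0 mulN1r addrA.
Qed.

Lemma fib_matrix_kerP (d : nat) (z : nat -> nat) (x : 'cV[rat]_d) :
  (forall j : 'I_d, x j 0 = (z j)%:R) ->
  fib_matrix d *m x = 0 <->
  (forall i, (i.+2 < d)%N -> z i.+2 = (z i + z i.+1)%N).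
Proof.
move=> xz; split=> [ker i lti|rec].
  have lti' : (i < d - 2)%N by lia.
  have := fib_matrix_mulE (Ordinal lti') xz.
  rewrite ker mxE /= => /esym/eqP; rewrite subr_eq0 -natrD eqr_nat.
  by move/eqP.
apply/colP => i; rewrite (fib_matrix_mulE i xz) mxE.
have lti2 : (i.+2 < d)%N by have := ltn_ord i; lia.
by apply/eqP; rewrite subr_eq0 -natrD eqr_nat rec.
Qed.

End Kernel.

Lemma rainbow_kerP (d : nat) (S : seq nat) (c : nat -> nat) : 1 < d ->
  (exists x : 'cV[rat]_d, rainbow S c x /\ (fib_matrix d *m x = 0)%R) <->
  (exists a b, (forall i, i < d -> gfib a b i \in S) /\
     (forall i j, i < j < d -> c (gfib a b i) <> c (gfib a b j))).
Proof.
move=> d1; split=> [[x [[y [xy yS yc]]] ker]|[a [b [inS col]]]].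
  case: d d1 x y xy yS yc ker => [|[|d]] // _ x y xy yS yc ker.
  pose z i := y (inord i).
  have xz (j : 'I_d.+2) : x j 0%R = ((z j)%:R)%R by rewrite xy /z inord_val.
  have /(fib_matrix_kerP xz) rec := ker.
  have zE := gfib_rec rec.
  exists (z 0), (z 1); split=> [i lti|i j /andP[lt_ij ltj]].
    by rewrite -zE //; apply: yS.
  rewrite -!zE //; last exact: ltn_trans ltj.
  by apply: yc; rewrite -val_eqE /= !inordK ?(ltn_trans lt_ij) ?neq_ltn ?lt_ij.
pose x : 'cV[rat]_d := (\col_i (gfib a b i)%:R)%R.
have xz (j : 'I_d) : x j 0%R = ((gfib a b j)%:R)%R by rewrite mxE.
exists x; split; last by apply/(fib_matrix_kerP xz) => i _; apply: gfibSS.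
exists (fun i => gfib a b i); split=> // [i|i j]; first exact: inS.
rewrite -val_eqE /= neq_ltn => /orP[lt|lt]; first by apply: col; rewrite lt /=.
by apply/nesym/col; rewrite lt /=.
Qed.

(** * The pair coloring and the lower bound *)

Lemma mem_interval N x : (x \in Defs.interval N) = (1 <= x <= N).
Proof. by rewrite mem_iota; lia. Qed.

(** Entry 0 of the table is a dummy. From 9 on, [nth] returns its default [uphalf x], which gives
    colors 5, 6, ... to consecutive pairs. *)
Definition pair_coloring (x : nat) : nat :=
  nth (uphalf x) [:: 0; 1; 2; 2; 1; 3; 4; 3; 4] x.

Lemma pair_coloring_large x : 8 < x -> pair_coloring x = uphalf x.
Proof. by move=> x8; rewrite /pair_coloring nth_default. Qed.

Lemma pair_coloring_count m j :
  count (fun x => pair_coloring x == j) (iota 1 ((m + 4) * 2)) =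
  (1 <= j <= m + 4) * 2.
Proof.
elim: m => [|m IH].
  by case: j => [|[|[|[|[|j]]]]].
have -> : (m.+1 + 4) * 2 = (m + 4) * 2 + 2 by lia.
rewrite iotaD count_cat IH /= !pair_coloring_large; lia.
Qed.

Lemma pair_coloring_equinumerous k : 3 < k ->
  equinumerous_coloring k 2 pair_coloring.
Proof.
move=> k3; have cnt j := pair_coloring_count (k - 4) j.
rewrite subnK // in cnt.
have sz j : 1 <= j <= k ->
    size (color_class (Defs.interval (k * 2)) pair_coloring j) = 2.
  by move=> jk; rewrite size_filter cnt jk.
split=> //; split=> [x|j /sz].
  (* A color out of range would have count 0, yet [x] has it. *)
  move=> xI; apply/negPn/negP => nx.
  have := cnt (pair_coloring x); rewrite (negPf nx) mul0n => /eqP.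
  rewrite -leqn0 leqNgt -has_count => /negP; apply.
  by apply/hasP; exists x.
case E: (color_class _ _ _) => [|x s] // _.
have : x \in color_class (Defs.interval (k * 2)) pair_coloring j.
  by rewrite E mem_head.
by rewrite mem_filter => /andP[/eqP cx xI]; exists x.
Qed.

Lemma fib_bounds n :
  [/\ fib n.+2 <= fib n.+3, fib n.+3 <= 2 * fib n.+2,
      3 * fib n.+3 <= 5 * fib n.+2 + 1 & 3 * fib n.+2 <= 2 * fib n.+3 + 1].
Proof.
elim: n => [|n [h1 h2 h3 h4]]; first by [].
by rewrite (fibSS n.+2); split; lia.
Qed.

Lemma rainbow_regular_lower d k : 3 < d -> 0 < k ->
  rainbow_partition_regular (fib_matrix d) k -> fib d.+1 <= k.
Proof.
move=> d3 k0 reg; have d1 : 1 < d by lia.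
have [k3|k3] := leqP k 3.
  (* For [k <= 3] all values get their own color, but a + 2b <= 3 forces a = b = 1, a repeated
     entry. *)
  have : equinumerous_coloring k 1 id.
    split=> [|j jk]; last first.
      rewrite /color_class size_filter count_uniq_mem ?iota_uniq //.
      by rewrite mem_interval muln1 jk.
    by split=> [x|j jk]; rewrite ?mem_interval ?muln1 //; exists j;
      rewrite ?mem_interval ?muln1.
  move=> /(reg 1 id isT) /(rainbow_kerP _ _ d1)[a [b [inS col]]].
  have := inS 0; have := inS 1; have := inS 3; rewrite !mem_interval.
  by have := col 0 1; rewrite /gfib /=; lia.
rewrite leqNgt; apply/negP => ltk.
have /(reg 2 _ isT)/(rainbow_kerP _ _ d1)[a [b [inS col]]] :=
  pair_coloring_equinumerous k3.
have a0 : 0 < a by have := inS 0; rewrite mem_interval /gfib /=; lia.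
have b0 : 0 < b by have := inS 1; rewrite mem_interval /gfib /=; lia.
have [n dE] : exists n, d = n.+4 by exists (d - 4); lia.
have := inS d.-1; rewrite dE /= leqnn mem_interval => /(_ isT) /andP[_ hi].
have {}hi : a * fib n.+2 + b * fib n.+3 <= k * 2 by [].
have [h1 h2 h3 h4] := fib_bounds n.
rewrite dE (fibSS n.+3) (fibSS n.+2) in ltk.
have col4 i j : i < j < 4 ->
    pair_coloring (gfib a b i) <> pair_coloring (gfib a b j).
  by move=> ij; apply: col; lia.
have := col4 0 1 isT; have := col4 0 2 isT; have := col4 0 3 isT.
have := col4 1 2 isT; have := col4 1 3 isT; have := col4 2 3 isT.
move: (fib n.+2) (fib n.+3) (fib_gt0 n.+1) => Q P Q0 in hi ltk h1 h2 h3 h4 *.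
rewrite /gfib [fib 0]/= [fib 1]/= [fib 2]/= [fib 3]/=.
(* As F_{d+1} = 2P + Q, [hi] and [ltk] give aQ + bP <= 4P + 2Q - 2. Then Q <= P excludes b >= 5, and
   3P <= 5Q + 1 bounds [a] for each [b]. *)
have b4 : b <= 4 by nia.
have : b = 1 \/ b = 2 \/ b = 3 \/ b = 4 by lia.
case=> [bE|[bE|[bE|bE]]]; subst b.
- have : a <= 6 by nia.
  by case: a a0 hi inS col col4 => [|[|[|[|[|[|[|a]]]]]]].
- have : a <= 5 by nia.
  by case: a a0 hi inS col col4 => [|[|[|[|[|[|a]]]]]].
- have : a <= 3 by nia.
  by case: a a0 hi inS col col4 => [|[|[|[|a]]]].
- have : a <= 1 by nia.
  by case: a a0 hi inS col col4 => [|[|a]].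
Qed.

(** * Counting lemmas for the upper bound *)

Lemma card_pairs (T1 T2 : finType) (R : T1 -> T2 -> bool) :
  #|[set p : T1 * T2 | R p.1 p.2]| = \sum_j #|[set i | R i j]|.
Proof.
rewrite -sum1dep_card -(pair_big_dep xpredT R (fun _ _ => 1)) /=.
rewrite (exchange_big_dep xpredT) //=; apply: eq_bigr => j _.
by rewrite sum1dep_card.
Qed.

Lemma card_ltn_pairs m :
  #|[set p : 'I_m * 'I_m | p.1 < p.2]| = 'C(m, 2).
Proof.
rewrite (card_pairs (fun i j : 'I_m => i < j)) -bin2_sum big_mkord.
apply: eq_bigr => j _.
rewrite -sum1dep_card -(big_ord_widen _ (fun=> 1) (ltnW (ltn_ord j))).
by rewrite sum1_card card_ord.
Qed.

Lemma leq_card_bigcup (I T : finType) (A : {set I}) (F : I -> {set T}) N :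
  (forall i, i \in A -> #|F i| <= N) -> #|\bigcup_(i in A) F i| <= #|A| * N.
Proof.
move=> leF; rewrite -sum_nat_const.
apply: (@leq_trans (\sum_(i in A) #|F i|)); last exact: leq_sum.
apply: (big_ind2 (fun (B : {set T}) n => #|B| <= n)) => [|B m C n leB leC|//].
  by rewrite cards0.
by apply: leq_trans (leq_card_setU _ _) _; apply: leq_add.
Qed.

(* For each [t < t' < m] the [P] by [Q] box [P (t' - t - 1) < a <= P (t' - t)],
   [Q t < b <= Q (t + 1)] lies in the triangle. *)
Lemma card_lattice_triangle P Q m : 0 < P -> 0 < Q ->
  P * Q * 'C(m, 2) <=
  #|[set p : 'I_(P * Q * m).+1 * 'I_(P * Q * m).+1 |
      [&& 0 < p.1, 0 < p.2 & p.1 * Q + p.2 * P <= P * Q * m]]|.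
Proof.
move=> P0 Q0; set M := P * Q * m.
pose f (x : ('I_P * 'I_Q) * ('I_m * 'I_m)) : 'I_M.+1 * 'I_M.+1 :=
  (inord (P * (x.2.2 - x.2.1.+1) + x.1.1.+1), inord (Q * x.2.1 + x.1.2.+1)).
pose D := setX [set: 'I_P * 'I_Q] [set p : 'I_m * 'I_m | p.1 < p.2].
have fE x : x \in D ->
    [/\ (f x).1 = P * (x.2.2 - x.2.1.+1) + x.1.1.+1 :> nat,
        (f x).2 = Q * x.2.1 + x.1.2.+1 :> nat
      & (f x).1 * Q + (f x).2 * P <= M].
  case: x => -[r s] [t t']; rewrite !inE /= => lt_t.
  have tm := ltn_ord t'; have rP := ltn_ord r; have sQ := ltn_ord s.
  have [u uE] : exists u, (t' : nat) = t + u.+1 by exists (t' - t.+1); lia.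
  have [w wE] : exists w, m = t + u.+1 + w.+1 by exists (m - t'.+1); lia.
  have -> : t' - t.+1 = u by lia.
  (* The far corner of the box has weight PQ(u + 1) + PQ(t + 1) = PQ(t' + 1) <= PQm. *)
  have bnd : (P * u + r.+1) * Q + (Q * t + s.+1) * P <= M.
    rewrite /M; have : r.+1 * Q <= P * Q by rewrite leq_mul.
    have : s.+1 * P <= Q * P by rewrite leq_mul.
    move: {tm lt_t uE} (nat_of_ord t) wE => v ->.
    by nia.
  have h1 : P * u + r.+1 < M.+1 by nia.
  have h2 : Q * t + s.+1 < M.+1 by nia.
  by rewrite !inordK.
have cardD : #|D| = P * Q * 'C(m, 2).
  by rewrite cardsX cardsT card_prod !card_ord card_ltn_pairs.
(* Division by [q] with remainder in 1..q is unique, so the boxes are disjoint. *)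
have edivE q a a' (r r' : 'I_q) :
    q * a + r.+1 = q * a' + r'.+1 -> a = a' /\ r = r'.
  rewrite !addnS => -[] e; have q0 : 0 < q by apply: leq_trans (ltn_ord r).
  have ea : a = a'.
    by have := congr1 (divn^~ q) e; rewrite !(mulnC q) !divnMDl // !divn_small ?addn0.
  by split=> //; apply: val_inj; move: e; rewrite ea; apply: addnI.
rewrite -cardD -(@card_in_imset _ _ f) => [|x y xD yD exy].
  apply/subset_leq_card/subsetP => _ /imsetP[x xD ->].
  by have [e1 e2 e3] := fE x xD; rewrite inE e3 e1 e2 !addnS.
have [x1 x2 _] := fE x xD; have [y1 y2 _] := fE y yD.
move: xD yD x1 x2 y1 y2; rewrite exy => {exy fE}.
case: x y => -[r s] [t t'] [[r1 s1] [t1 t1']]; rewrite !inE /= => lt lt1 -> ->.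
move=> /edivE[et ->] /edivE[/val_inj et1 ->]; subst t1.
by congr ((_, _), (_, _)); apply: val_inj => /=; lia.
Qed.

Lemma card_mono_pairs k n c : equinumerous_coloring k n c ->
  #|[set p : 'I_(k * n).+1 * 'I_(k * n).+1 |
      [&& 0 < p.1, 0 < p.2, p.1 != p.2 & c p.1 == c p.2]]| <= k * n * n.-1.
Proof.
move=> [[cI _] csz]; set M := k * n.
have card_class j : 1 <= j <= k -> #|[set v : 'I_M.+1 | 0 < v & c v == j]| = n.
  move=> /csz <-; rewrite -sum1dep_card.
  rewrite -(big_mkord (fun v => (0 < v) && (c v == j)) (fun=> 1)).
  rewrite big_ltn_cond //= big_nat_cond (eq_bigl (fun v => (0 < v < M.+1) && (c v == j))).
    rewrite -big_nat_cond sum1_count /index_iota subSS subn0 size_filter.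
    by [].
  by move=> v; rewrite /=; lia.
rewrite (card_pairs (fun u v : 'I_M.+1 => [&& 0 < u, 0 < v, u != v & c u == c v])).
(* The ordinal 0 lies outside the interval and contributes nothing; each other [v] has n - 1
   partners in its class. *)
rewrite (bigID (fun v => v == ord0)) /= big_pred1_eq.
have -> : #|[set i : 'I_M.+1 | [&& 0 < i, 0 < @ord0 M, i != ord0 & c i == c (@ord0 M)]]| = 0.
  by apply: eq_card0 => i; rewrite inE andbF.
rewrite add0n (eq_bigr (fun=> n.-1)) => [|v v0].
  by rewrite sum_nat_const (cardC1 ord0) card_ord.
have v1 : 0 < v by rewrite lt0n.
have ck : 1 <= c v <= k.
  by apply: cI; rewrite mem_iota v1 add1n ltn_ord.
have := cardsD1 v [set u : 'I_M.+1 | 0 < u & c u == c v].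
rewrite card_class // !inE v1 eqxx add1n => /(congr1 predn) /= ->.
by apply: eq_card => u; rewrite !inE andbCA.
Qed.

(** With C = binom(d,2), the constant d^2 - d + 1 is 2C + 1. Doubling and dividing by X(2C + 1)n
    leaves 2 + 2C(n - 1) < (2C + 1)n - 1, that is 3 < 2C + n. *)
Lemma count_gap d n X : 3 < d -> 0 < n -> 0 < X ->
  X * ((d ^ 2 - d + 1) * n) + 'C(d, 2) * (X * ((d ^ 2 - d + 1) * n) * n.-1) <
  X * 'C((d ^ 2 - d + 1) * n, 2).
Proof.
move=> d3 n0 X0.
have binE m : 'C(m, 2) * 2 = m * m.-1 by rewrite mulnC -mul_bin_diag bin1.
have -> : d ^ 2 - d + 1 = ('C(d, 2) * 2).+1.
  by rewrite binE expnS expn1 -subn1 mulnBr muln1 addn1.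
have C6 : 6 <= 'C(d, 2) by have := binE d; nia.
rewrite -(ltn_pmul2r (m := 2)) // -[X in _ < X]mulnA (binE (_ * _)).
move: ('C(d, 2)) C6 => C C6; case: n n0 => // n _.
have ltm : 2 + C * n * 2 < ((C * 2).+1 * n.+1).-1 by lia.
have -> : (C * 2).+1 * n.+1 = ((C * 2).+1 * n.+1).-1.+1 by lia.
move: (((C * 2).+1 * n.+1).-1) ltm => m ltm /=.
have -> : (X * m.+1 + C * (X * m.+1 * n)) * 2 = X * m.+1 * (2 + C * n * 2).
  by move: (X * m.+1) => Y; lia.
by rewrite [X in _ < X]mulnA ltn_pmul2l ?muln_gt0 ?X0.
Qed.

(** * The upper bound *)

Lemma rainbow_regular_upper d : 3 < d ->
  rainbow_partition_regular (fib_matrix d)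
    ((d ^ 2 - d + 1) * (fib (d - 1) * fib (d - 2))).
Proof.
move=> d3 n c n0.
have [e dE] : exists e, d = e.+4 by exists (d - 4); lia.
have -> : fib (d - 1) = fib e.+3 by congr fib; lia.
have -> : fib (d - 2) = fib e.+2 by congr fib; lia.
have gfib_last a b : gfib a b d.-1 = a * fib e.+2 + b * fib e.+3 by rewrite dE.
move: (fib e.+3) (fib e.+2) (fib_gt0 e.+2) (fib_gt0 e.+1) gfib_last.
move=> P Q P0 Q0 gfib_last {e dE}.
set k := _ * (P * Q) => eqc.
have kE : k * n = P * Q * ((d ^ 2 - d + 1) * n) by rewrite /k; lia.
apply/rainbow_kerP; first by lia.
(* Seeds of the positive kernel vectors in range: the last entry is the largest, so bounding it
   suffices. *)
pose S := [set p : 'I_(k * n).+1 * 'I_(k * n).+1 |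
  [&& 0 < p.1, 0 < p.2 & gfib p.1 p.2 d.-1 <= k * n]].
pose rb (p : 'I_(k * n).+1 * 'I_(k * n).+1) :=
  [forall i : 'I_d, forall j : 'I_d,
     (i < j) ==> (c (gfib p.1 p.2 i) != c (gfib p.1 p.2 j))].
case: (boolP [exists p in S, rb p]) => [/exists_inP[[a b]]|none].
  rewrite inE /= => /and3P[a0 b0 le_last] /forallP col.
  exists a, b; split=> [i lti|i j /andP[lt_ij ltj]].
    rewrite mem_interval gfib_gt0 //=.
    by apply: leq_trans le_last; apply: gfib_le => //; apply: ltnW.
  have := forallP (col (Ordinal (ltn_trans lt_ij ltj))) (Ordinal ltj).
  by rewrite /= lt_ij => /eqP.
exfalso.
pose W := [set p : 'I_(k * n).+1 * 'I_(k * n).+1 |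
  [&& 0 < p.1, 0 < p.2, p.1 != p.2 & c p.1 == c p.2]].
(* The diagonal is set apart because [W] requires two distinct values, while for a = b entries 0 and
   1 coincide. *)
pose E := [set (i, i) | i in predC1 (@ord0 (k * n))].
(* On [S] the entries are in range by [leS], so [inord] preserves them and [entries q] inherits
   injectivity from [gfib_inj]. *)
pose entries (q : 'I_d * 'I_d) (p : 'I_(k * n).+1 * 'I_(k * n).+1) :=
  (inord (gfib p.1 p.2 q.1), inord (gfib p.1 p.2 q.2))
  : 'I_(k * n).+1 * 'I_(k * n).+1.
pose B (q : 'I_d * 'I_d) := [set p in S | entries q p \in W].
pose L := [set q : 'I_d * 'I_d | q.1 < q.2].
have leS p i : p \in S -> i < d -> gfib p.1 p.2 i < (k * n).+1.
  rewrite inE ltnS => /and3P[a0 b0 le_last] ltid; apply: leq_trans le_last.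
  by apply: gfib_le => //; apply: ltnW.
have cover : S \subset E :|: \bigcup_(q in L) B q.
  apply/subsetP => p pS; rewrite inE; apply/orP.
  have [a0 b0 le_last] : [/\ 0 < p.1, 0 < p.2 & gfib p.1 p.2 d.-1 <= k * n].
    by apply/and3P; move: pS; rewrite inE.
  have [eab|neab] := eqVneq p.1 p.2.
    left; apply/imsetP; exists p.1; last by case: p eab {pS a0 b0 le_last} => x y /= ->.
    by rewrite inE /= -val_eqE /= -lt0n.
  right; move: none; rewrite negb_exists_in => /forall_inP/(_ p pS).
  rewrite negb_forall => /existsP[i]; rewrite negb_forall => /existsP[j].
  rewrite negb_imply negbK => /andP[lt_ij /eqP ecol].
  apply/bigcupP; exists (i, j); rewrite !in_set //= a0 b0 le_last -val_eqE /=.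
  rewrite !inordK ?leS // !gfib_gt0 // ecol eqxx andbT /=.
  exact: gfib_neq.
have cardB q : q \in L -> #|B q| <= k * n * n.-1.
  rewrite inE => lt_q; apply: leq_trans (card_mono_pairs eqc).
  rewrite -(@card_in_imset _ _ (entries q)) => [|p p'].
    apply/subset_leq_card/subsetP => _ /imsetP[p pB ->].
    by have /setIdP[] := pB.
  move=> /setIdP[pS _] /setIdP[p'S _] [].
  move=> /(congr1 val) /= e1 /(congr1 val) /= e2.
  move: e1 e2; rewrite !inordK ?leS // => e1 e2.
  have [] := gfib_inj lt_q e1 e2.
  by case: p p' {pS p'S e1 e2} => a b [a' b'] /= /val_inj -> /val_inj ->.
have cardE : #|E| <= k * n.
  by apply: leq_trans (leq_imset_card _ _) _; rewrite cardC1 card_ord.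
have upper : #|S| <= k * n + 'C(d, 2) * (k * n * n.-1).
  apply: leq_trans (subset_leq_card cover) _.
  apply: leq_trans (leq_card_setU _ _) _; apply: leq_add => //.
  by rewrite -card_ltn_pairs; apply: leq_card_bigcup.
have lower : P * Q * 'C((d ^ 2 - d + 1) * n, 2) <= #|S|.
  apply: leq_trans (card_lattice_triangle _ P0 Q0) _; rewrite /S kE.
  apply/eq_leq/eq_card => p; rewrite !inE.
  by rewrite gfib_last.
have := leq_trans lower upper; apply/negP; rewrite -ltnNge.
by rewrite kE; apply: count_gap; rewrite // muln_gt0 P0.
Qed.

(** * Existence of the rainbow number *)

Theorem theorem2 (d : nat) (hd : 3 < d) :
  exists r : nat,
    is_rainbow_number (fib_matrix d) r /\
    fib d.+1 <= r <= (d ^ 2 - d + 1) * (fib (d - 1) * fib (d - 2)).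
Proof.
pose reg := rainbow_partition_regular (fib_matrix d).
have least k : 0 < k -> reg k ->
    exists2 r, is_rainbow_number (fib_matrix d) r & r <= k.
  elim/ltn_ind: k => k IH k0 regk.
  (* [reg] quantifies over all [n] and all colorings, so excluded middle decides whether a smaller
     regular value exists. *)
  have [[j [j0 ltjk regj]]|noj] := classic (exists j, [/\ 0 < j, j < k & reg j]).
    by have [r rr lerj] := IH j ltjk j0 regj; exists r => //; lia.
  exists k => //; split=> // j j0 regj; rewrite leqNgt; apply/negP => ltjk.
  by apply: noj; exists j.
have [|r rr ler] := least _ _ (rainbow_regular_upper hd).
  have -> : d - 1 = (d - 3).+2 by lia.
  have -> : d - 2 = (d - 3).+1 by lia.
  by rewrite !muln_gt0 !fib_gt0 addn1.
exists r; split=> //; rewrite ler andbT.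
by have [r0 regr _] := rr; apply: rainbow_regular_lower.
Qed.
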